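(* Let $T\ge 1$ and $n\ge 1$ be integers. For each $t\in\{1,\dots,T\}$ let $L_t:\mathbb{R}^n\times\mathbb{R}^n\to\mathbb{R}\cup\{+\infty\}$ be proper, convex and lower semicontinuous, and let $g:\mathbb{R}^n\to\mathbb{R}\cup\{+\infty\}$ be proper, convex and lower semicontinuous. Let $\vartheta_\tau$ and $\omega_\tau$ be the primal and dual value functions defined in the context. Assume that there exists $\{\bar x_t\}_{t=0}^T\subset\mathbb{R}^n$ such that $\bar x_T\in\operatorname{ri}(\operatorname{dom}(g))$ and, for all $t\in\{1,\dots,T\}$, $\bar x_{t-1}\in\operatorname{ri}(\mathbf{X}(t))$ and $\Delta\bar x_t\in\operatorname{ri}(\Gamma_L(t,\bar x_{t-1}))$. Then, for any $\tau\in\{0,\dots,T\}$, $\vartheta_\tau^*=\omega_\tau$. Moreover, the infimum in the definition of $\omega_\tau(\eta)$ is attained for any $\eta\in\operatorname{dom}(\omega_\tau)$.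
   Context: Notation: for a sequence, $\Delta x_t:=x_t-x_{t-1}$. For an extended-real-valued function $\varphi$, $\operatorname{dom}(\varphi)=\{x:\varphi(x)<+\infty\}$; $\varphi$ is proper if $\operatorname{dom}(\varphi)\ne\emptyset$ and $\varphi>-\infty$ everywhere; $\operatorname{ri}(S)$ is the relative interior of a convex set $S$; the conjugate is $\varphi^*(y)=\sup_x\{x\cdot y-\varphi(x)\}$ (values in $\mathbb{R}\cup\{\pm\infty\}$). Primal value function: for $\tau\in\{0,\dots,T-1\}$ and $\xi\in\mathbb{R}^n$, $$\vartheta_\tau(\xi):=\inf\Big\{\sum_{t=\tau+1}^T L_t(x_{t-1},\Delta x_t)+g(x_T)\ :\ \{x_t\}_{t=\tau}^T\subset\mathbb{R}^n,\ x_\tau=\xi\Big\},$$ and $\vartheta_T(\xi):=g(\xi)$. Dual value function: with $f(b):=g^*(-b)$ and $K_t(p,w):=\sup_{x,v\in\mathbb{R}^n}\{x\cdot w+v\cdot p-L_t(x,v)\}$, for $\tau\in\{0,\dots,T-1\}$ and $\eta\in\mathbb{R}^n$, $$\omega_\tau(\eta):=\inf\Big\{\sum_{t=\tau+1}^T K_t(p_t,\Delta p_t)+f(p_T)\ :\ \{p_t\}_{t=\tau}^T\subset\mathbb{R}^n,\ p_\tau=-\eta\Big\},$$ and $\omega_T(\eta):=f(-\eta)$ (for $\tau=T$ no infimum is involved, so attainment is trivial). Constraint maps: $\Gamma_L(t,x):=\{v\in\mathbb{R}^n: L_t(x,v)\in\mathbb{R}\}$ and $\mathbf{X}(t):=\{x\in\mathbb{R}^n:\Gamma_L(t,x)\neq\emptyset\}$.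 *)

(* Defs.v *)
From HB Require Import structures.
From mathcomp Require Import all_boot all_order all_algebra.
From mathcomp Require Import all_classical all_reals all_analysis.

Set Implicit Arguments.
Unset Strict Implicit.
Unset Printing Implicit Defensive.

Import Order.TTheory GRing.Theory Num.Theory.
Import numFieldNormedType.Exports.

Local Open Scope classical_set_scope.
Local Open Scope ring_scope.
Local Open Scope ereal_scope.

Section ExtendedRealFunctions.
Context {R : realType}.

Definition edom {X : Type} (phi : X -> \bar R) : set X :=
  [set x | phi x < +oo].

Definition eproper {X : Type} (phi : X -> \bar R) : Prop :=
  edom phi !=set0 /\ forall x, -oo < phi x.

(* Only meant for functions that never take the value -oo: for those, the
   right-hand side is never an indeterminate sum. *)
Definition econvex {E : lmodType R} (phi : E -> \bar R) : Prop :=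
  forall (x y : E) (s : R), (0 < s < 1)%R ->
    phi (s *: x + (1 - s) *: y)%R <= s%:E * phi x + (1 - s)%:E * phi y.

Definition affine_set {E : lmodType R} (A : set E) : Prop :=
  forall (x y : E) (s : R), A x -> A y -> A (s *: x + (1 - s) *: y)%R.

Definition affine_hull {E : lmodType R} (A : set E) : set E :=
  smallest affine_set A.

(* The interior of A for the topology induced on its affine hull. *)
Definition relint {E : normedModType R} (A : set E) : set E :=
  [set x | affine_hull A x /\ \forall y \near x, affine_hull A y -> A y].

Definition dot {n : nat} (x y : 'rV[R]_n) : R := (\sum_(i < n) x 0 i * y 0 i)%R.

Definition conjugate {n : nat} (phi : 'rV[R]_n -> \bar R) (y : 'rV[R]_n) :
    \bar R :=
  ereal_sup [set (dot x y)%:E - phi x | x in [set: 'rV[R]_n]].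

End ExtendedRealFunctions.

(* Sequences x_tau, ..., x_T are functions on nat of which only the values at
   indices in [tau, T] matter; likewise L t matters only for 1 <= t <= T. *)
Section ValueFunctions.
Context {R : realType} {n : nat}.
Local Notation V := 'rV[R]_n.

(* Used only at t >= 1. *)
Definition Delta (x : nat -> V) (t : nat) : V := (x t - x t.-1)%R.

Definition primal_cost (T : nat) (L : nat -> V * V -> \bar R) (g : V -> \bar R)
    (tau : nat) (x : nat -> V) : \bar R :=
  \sum_(tau.+1 <= t < T.+1) L t (x t.-1, Delta x t) + g (x T).

Definition primal_value (T : nat) (L : nat -> V * V -> \bar R)
    (g : V -> \bar R) (tau : nat) (xi : V) : \bar R :=
  if (tau < T)%N then
    ereal_inf [set primal_cost T L g tau x | x in [set x | x tau = xi]]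
  else g xi.

Definition dual_terminal (g : V -> \bar R) (b : V) : \bar R :=
  conjugate g (- b)%R.

Definition dual_lagrangian (L : nat -> V * V -> \bar R) (t : nat) (p w : V) :
    \bar R :=
  ereal_sup [set (dot z.1 w + dot z.2 p)%:E - L t z | z in [set: V * V]].

Definition dual_cost (T : nat) (L : nat -> V * V -> \bar R) (g : V -> \bar R)
    (tau : nat) (p : nat -> V) : \bar R :=
  \sum_(tau.+1 <= t < T.+1) dual_lagrangian L t (p t) (Delta p t)
  + dual_terminal g (p T).

Definition dual_value (T : nat) (L : nat -> V * V -> \bar R) (g : V -> \bar R)
    (tau : nat) (eta : V) : \bar R :=
  if (tau < T)%N then
    ereal_inf [set dual_cost T L g tau p | p in [set p | p tau = (- eta)%R]]
  else dual_terminal g (- eta)%R.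

Definition GammaL (L : nat -> V * V -> \bar R) (t : nat) (x : V) : set V :=
  [set v | L t (x, v) \is a fin_num].

Definition Xset (L : nat -> V * V -> \bar R) (t : nat) : set V :=
  [set x | GammaL L t x !=set0].

End ValueFunctions.

(* Main.v *)
(* Relax the dynamics: let positions [x] and velocities [v] vary independently
   and treat [v t = Delta x t] as affine constraints. Minus the conjugate of the
   primal value at [eta] is then the value of a convex program, and its Lagrange
   multipliers for these constraints are exactly an optimal dual arc: once the
   multipliers are found, the Lagrangian splits into independent suprema, namely
   the terms of the dual cost. Multipliers exist by a purely algebraic argument,
   adding one scalar constraint at a time, as soon as every feasible point
   violating the constraints by [u] is matched by one violating them by [- e u]
   for some [e > 0]; the relative interior hypothesis supplies the latter by
   prolonging segments slightly beyond [xbar]. *)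
Require Import Defs.
From mathcomp Require Import all_boot all_order all_algebra.
From mathcomp Require Import all_classical all_reals all_analysis.
From mathcomp Require Import ring lra.

Import Order.TTheory GRing.Theory Num.Theory.
Import numFieldNormedType.Exports.

Local Open Scope classical_set_scope.
Local Open Scope ring_scope.
Local Open Scope ereal_scope.

(** * Convexity and Lagrange multipliers for affine constraints *)

Definition mix {R : realType} {E : lmodType R} (s : R) (x y : E) : E :=
  (s *: x + (1 - s) *: y)%R.

Definition convex_subset {R : realType} {E : lmodType R} (D : set E) : Prop :=
  forall (x y : E) (s : R), (0 < s < 1)%R -> D x -> D y -> D (mix s x y).

Definition convex_on {R : realType} {E : lmodType R} (D : set E) (h : E -> R) :
    Prop :=
  forall (x y : E) (s : R), (0 < s < 1)%R -> D x -> D y ->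
    (h (mix s x y) <= s * h x + (1 - s) * h y)%R.

Definition affine_form {R : realType} {E : lmodType R} (l : E -> R) : Prop :=
  forall (x y : E) (s : R), l (mix s x y) = (s * l x + (1 - s) * l y)%R.

(* The multiplier is any number separating the slopes [h / l] on [l < 0] from
   those on [l > 0]; the last hypothesis makes both sides inhabited at once. *)
Lemma lagrange_multiplier1 (R : realType) (E : lmodType R) (D : set E)
    (h l : E -> R) :
  convex_subset D -> convex_on D h -> affine_form l ->
  (forall z, D z -> l z = 0%R -> (0 <= h z)%R) ->
  (forall z, D z -> exists e z', [/\ (0 < e)%R, D z' & l z' = (- e * l z)%R]) ->
  exists a : R, forall z, D z -> (a * l z <= h z)%R.
Proof.
move=> Dc hc la h0 lopp.
have slope z z' : D z -> D z' -> (0 < l z)%R -> (l z' < 0)%R ->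
    (h z' / l z' <= h z / l z)%R.
  move=> Dz Dz' lz lz'.
  have d0 : (0 < l z - l z')%R by lra.
  (* The weight at which [l] vanishes on the segment between [z] and [z'], so that [h0] applies
     there. *)
  pose s := (- l z' / (l z - l z'))%R.
  have s01 : (0 < s < 1)%R.
    by rewrite /s divr_gt0 ?oppr_gt0//= ltr_pdivrMr//; lra.
  have sE : (s * (l z - l z') = - l z')%R by rewrite /s divfK// gt_eqF.
  have := hc _ _ _ s01 Dz Dz'.
  have := h0 _ (Dc _ _ _ s01 Dz Dz').
  rewrite la => /(_ ltac:(lra)) H1 H2.
  have H3 : (0 <= - l z' * h z + l z * h z')%R.
    have -> : (- l z' * h z + l z * h z' =
        (l z - l z') * (s * h z + (1 - s) * h z'))%R.
      transitivity (s * (l z - l z') * h z +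
        (l z - l z' - s * (l z - l z')) * h z')%R; last by ring.
      by rewrite sE; ring.
    by apply: mulr_ge0 (ltW d0) (le_trans H1 H2).
  by rewrite ler_ndivrMr// mulrAC ler_pdivrMr//; lra.
pose S := [set (h z / l z)%R | z in [set z | D z /\ (l z < 0)%R]].
exists (sup S) => z Dz.
have [lz|lz|lz] := ltgtP (l z) 0%R.
- rewrite -ler_ndivrMr//; apply: ub_le_sup; last by exists z.
  have [e [z' [e0 Dz' lz']]] := lopp _ Dz.
  exists (h z' / l z')%R => _ [w [Dw lw] <-]; apply: slope => //.
  by rewrite lz'; nra.
- rewrite -ler_pdivlMr//; apply: ge_sup.
    have [e [z' [e0 Dz' lz']]] := lopp _ Dz.
    by exists (h z' / l z')%R, z' => //; split => //; rewrite lz'; nra.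
  by move=> _ [w [Dw lw] <-]; apply: slope.
- by rewrite lz mulr0 h0.
Qed.

(** Induction on the constraints: those of the tail are handled first, on the slice [D0] where the
    head one holds. Subtracting their weighted sum [Q] from [h] then leaves a problem on [D] with
    the head as its only constraint. *)
Lemma lagrange_multipliers (R : realType) (E : lmodType R) (J : eqType)
    (s : seq J) (l : J -> E -> R) (D : set E) (h : E -> R) :
  uniq s -> convex_subset D -> convex_on D h -> (forall j, affine_form (l j)) ->
  (forall z, D z -> (forall j, j \in s -> l j z = 0%R) -> (0 <= h z)%R) ->
  (forall z, D z -> exists e z',
     [/\ (0 < e)%R, D z' & forall j, j \in s -> l j z' = (- e * l j z)%R]) ->
  exists q : J -> R, forall z, D z -> (\sum_(j <- s) q j * l j z <= h z)%R.
Proof.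
elim: s D h => [|j s IH] D h /=.
  move=> _ _ _ _ h0 _; exists (fun=> 0%R) => z Dz.
  by rewrite big_nil; apply: h0.
move=> /andP[js us] Dc hc la h0 lopp.
pose D0 := [set z | D z /\ l j z = 0%R].
have [||||q qP] := IH D0 h us _ _ la.
- move=> x y c c01 [Dx lx] [Dy ly]; split; first exact: Dc.
  by rewrite la lx ly !mulr0 addr0.
- by move=> x y c c01 [Dx _] [Dy _]; apply: hc.
- move=> z [Dz lz] ls; apply: h0 => // i; rewrite inE => /predU1P[->//|].
  exact: ls.
- move=> z [Dz lz]; have [e [z' [e0 Dz' lz']]] := lopp _ Dz.
  exists e, z'; split=> //.
    by split => //; rewrite lz' ?mem_head// lz mulr0.
  by move=> i si; rewrite lz'// inE si orbT.
pose Q z := (\sum_(i <- s) q i * l i z)%R.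
have Qa x y c : Q (mix c x y) = (c * Q x + (1 - c) * Q y)%R.
  rewrite /Q !mulr_sumr -big_split; apply: eq_bigr => i _ /=.
  by rewrite la; ring.
have [||||a aP] := @lagrange_multiplier1 R E D (fun z => h z - Q z)%R (l j) Dc.
- move=> x y c c01 Dx Dy; rewrite Qa.
  by have := hc _ _ _ c01 Dx Dy; lra.
- exact: la.
- by move=> z Dz lz; rewrite subr_ge0; apply: qP.
- move=> z Dz; have [e [z' [e0 Dz' lz']]] := lopp _ Dz.
  by exists e, z'; split=> //; rewrite lz' ?mem_head.
exists (fun i => if i == j then a else q i) => z Dz.
rewrite big_cons eqxx [X in (_ + X <= _)%R](_ : _ = Q z).
  by have := aP _ Dz; lra.
apply: eq_big_seq => i si; case: eqP => // ij.
by move: js; rewrite -ij si.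
Qed.

(** * Relative interiors, and sums of suprema in the extended reals *)

Lemma relint_sub (R : realType) (E : normedModType R) (A : set E) :
  relint A `<=` A.
Proof. by move=> x [hx /nbhs_singleton]; apply. Qed.

(** The prolonged point tends to [x] as [e] decreases to 0 and stays on the line through [x] and
    [y], hence in the affine hull of [A]. *)
Lemma relint_prolong (R : realType) (E : normedModType R) (A : set E) (x y : E) :
  relint A x -> A y -> exists2 e : R, (0 < e)%R & A (x - e *: (y - x))%R.
Proof.
move=> [hx nx] Ay.
have c : ((fun e : R => x - e *: (y - x)) @ 0^'+ --> x)%R.
  rewrite -[X in _ --> X]subr0 -[X in (_ --> _ - X)%R](scale0r (y - x)%R).
  apply: cvgB; first exact: cvg_cst.
  by apply: cvgZr_tmp; apply: cvg_within.
have : \forall e \near 0^'+%R, (affine_hull A (x - e *: (y - x)) ->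
    A (x - e *: (y - x)))%R by exact: c nx.
move=> H; have [e [he e0]] := filter_ex (filterI H (nbhs_right_gt (0 : R))).
exists e => //; apply: he => B [Baff AB].
have -> : (x - e *: (y - x) = (1 + e) *: x + (1 - (1 + e)) *: y)%R.
  rewrite [(1 - (1 + e))%R](_ : _ = - e)%R; last by ring.
  by rewrite scaleNr scalerDl scale1r -addrA scalerBr opprB.
exact: (Baff x y (1 + e)%R (hx B (conj Baff AB)) (AB y Ay)).
Qed.

(* For arbitrary extended reals, thanks to the convention [+oo + -oo = -oo]. *)
Lemma ereal_sup_addr_le (R : realType) (S : set (\bar R)) (c M : \bar R) :
  (forall x, S x -> x + c <= M) -> ereal_sup S + c <= M.
Proof.
case: c => [c| |] H; last by rewrite addeNy leNye.
- rewrite -leeBrDr//; apply: ge_ereal_sup => x Sx.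
  by rewrite leeBrDr//; exact: H.
- case: M H => [M| |] H; rewrite ?leey//.
  + rewrite (_ : ereal_sup S = -oo) ?addNye ?leNye//.
    apply/ereal_sup_ninfty => x Sx; have := H _ Sx.
    by case: x Sx => //= r; rewrite leye_eq.
  + rewrite (_ : ereal_sup S = -oo) ?addNye ?leNye//.
    apply/ereal_sup_ninfty => x Sx; have := H _ Sx.
    by case: x Sx => //= r; rewrite leye_eq.
Qed.

(** Each summand has its own free variable, so the suprema can be treated one at a time. The extra
    term [c] carries the summands already fixed through the induction. *)
Lemma sum_ereal_sup_addr_le (R : realType) (Z : Type) (s : seq nat)
    (a : nat -> Z -> \bar R) (c M : \bar R) (z0 : Z) :
  uniq s ->
  (forall z : nat -> Z, \sum_(t <- s) a t (z t) + c <= M) ->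
  \sum_(t <- s) ereal_sup [set a t z | z in [set: Z]] + c <= M.
Proof.
elim: s c => [|t s IH] c /=; first by move=> _ /(_ (fun=> z0)); rewrite !big_nil.
move=> /andP[ts us] H; rewrite big_cons -addeA.
apply: ereal_sup_addr_le => _ [w _ <-].
rewrite addeCA; apply: IH => // z.
(* Altering the family at [t] alone leaves the other terms unchanged, because [t] is not in [s]. *)
have := H (fun i => if i == t then w else z i).
rewrite big_cons eqxx -addeA addeCA; congr (_ + _ <= _).
by apply: eq_big_seq => i si; case: eqP => // it; move: ts; rewrite -it si.
Qed.

(** * Prolonging segments inside the domain of a convex function *)

Lemma convex_fin_num (R : realType) (E : lmodType R) (phi : E -> \bar R) :
  econvex phi -> (forall x, -oo < phi x) ->
  convex_subset [set x | phi x \is a fin_num].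
Proof.
move=> phic phiN x y s s01 /= fx fy; rewrite fin_numElt phiN /=.
apply: le_lt_trans (phic _ _ _ s01) _.
by rewrite -(fineK fx) -(fineK fy) -!EFinM -EFinD ltry.
Qed.

Lemma convex_on_fine (R : realType) (E : lmodType R) (phi : E -> \bar R) :
  econvex phi -> (forall x, -oo < phi x) ->
  convex_on [set x | phi x \is a fin_num] (fine \o phi).
Proof.
move=> phic phiN x y s s01 fx fy /=.
have fxy := convex_fin_num _ _ _ phic phiN _ _ _ s01 fx fy.
rewrite -lee_fin fineK// EFinD !EFinM !fineK//.
exact: phic.
Qed.

(* [x] is a relative algebraic interior point of [D] when this holds for all
   [y] in [D]. *)
Definition prolongs {R : realType} {E : lmodType R} (D : set E) (x y : E) : Prop :=
  exists2 e0 : R, (0 < e0)%R &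
    forall e : R, (0 < e <= e0)%R -> D (x - e *: (y - x))%R.

(** Shorter steps follow from the longest one by convexity, since they end between [x] and the point
    reached at [e0]. *)
Lemma convex_prolongs (R : realType) (E : lmodType R) (D : set E) (x y : E)
    (e0 : R) :
  convex_subset D -> D x -> (0 < e0)%R -> D (x - e0 *: (y - x))%R ->
  prolongs D x y.
Proof.
move=> Dc Dx e00 De0; exists e0 => // e /andP[e_gt0].
rewrite le_eqVlt => /predU1P[->//|ee0].
have s01 : (0 < e / e0 < 1)%R by rewrite divr_gt0//= ltr_pdivrMr// mul1r.
rewrite (_ : x - e *: (y - x) = mix (e / e0) (x - e0 *: (y - x)) x)%R.
  exact: Dc.
rewrite /mix (scalerBr (e / e0)%R x) scalerA divfK ?gt_eqF// scalerBl scale1r.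
by rewrite [RHS]addrC subrKA.
Qed.

(* Prolong in the position, average back to the fibre over [xb], prolong the
   velocity there, and recombine so that the auxiliary velocity cancels. *)
Lemma graph_prolongs (R : realType) (n : nat)
    (L : nat -> 'rV[R]_n * 'rV[R]_n -> \bar R) (t : nat) (xb vb : 'rV[R]_n)
    (z : 'rV[R]_n * 'rV[R]_n) :
  eproper (L t) -> econvex (L t) ->
  relint (Xset L t) xb -> relint (GammaL L t xb) vb ->
  L t z \is a fin_num -> prolongs [set z | L t z \is a fin_num] (xb, vb) z.
Proof.
move=> [_ LN] Lc rx rv; case: z => x v Lz.
have Dc := convex_fin_num _ _ _ Lc LN.
have Xx : Xset L t x by exists v.
have [d d0 [w Lw]] := relint_prolong _ _ _ _ _ rx Xx.
have d1 : (1 + d != 0)%R by rewrite gt_eqF// ltr_wpDl.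
(* The same weight applied to the positions [xb - d *: (x - xb)] and [x] gives back [xb]. *)
pose m := mix (1 + d)^-1%R w v.
have Lm : GammaL L t xb m.
  rewrite /GammaL /=.
  have s01 : (0 < (1 + d)^-1 < 1)%R.
    by rewrite invr_gt0 addr_gt0//= invf_lt1 ?ltrDl// addr_gt0.
  have := Dc _ _ _ s01 Lw Lz; congr (L t (_, _) \is a fin_num).
  by apply/rowP => i; rewrite !mxE; field.
have [c c0 Lc'] := relint_prolong _ _ _ _ _ rv Lm.
have dc : (1 + d + c != 0)%R by rewrite gt_eqF// !addr_gt0.
(* Solves [s = (1 - s) * c / (1 + d)], which cancels [w] in the recombined velocity. *)
pose s := (c / (1 + d + c))%R.
have s0 : (0 < s)%R by rewrite divr_gt0// !addr_gt0.
have s01 : (0 < s < 1)%R.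
  by rewrite s0/= /s ltr_pdivrMr ?mul1r ?ltrDr ?addr_gt0// addr_gt0.
apply: (convex_prolongs _ _ _ _ _ (s * d)%R Dc).
- exact: relint_sub rv.
- exact: mulr_gt0.
have := Dc _ _ _ s01 Lw Lc'; congr (L t (_, _) \is a fin_num).
- by apply/rowP => i; rewrite !mxE; ring.
- by apply/rowP => i; rewrite !mxE /s; field; rewrite d1 dc.
Qed.

(** Finitely many positive thresholds have a positive minimum; this provides one step length valid
    at all times at once. *)
Lemma uniform_prolongation (R : realType) (J : eqType) (s : seq J)
    (P : J -> R -> Prop) :
  (forall j, j \in s ->
     exists2 e0, (0 < e0)%R & forall e, (0 < e <= e0)%R -> P j e) ->
  exists2 e0, (0 < e0)%R & forall j e, j \in s -> (0 < e <= e0)%R -> P j e.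
Proof.
elim: s => [|j s IH] H; first by exists 1%R.
have [i si|e1 e10 H1] := IH; first by apply: H; rewrite inE si orbT.
have [e2 e20 H2] := H j (mem_head _ _).
exists (Num.min e1 e2); first by rewrite lt_min e10.
move=> i e; rewrite inE le_min => /predU1P[->|si] /and3P[e0 ee1 ee2].
  by apply: H2; rewrite e0.
by apply: H1 => //; rewrite e0.
Qed.

(** * Summation by parts and finite sums of extended reals *)

(** The products [dot (x t) (p t)] telescope, leaving boundary terms and the pairing of [p] with the
    defect [v t - Delta x t]. The defect is zero along a trajectory (weak duality); otherwise its
    pairing with [p] is the Lagrangian term (strong duality). *)
Lemma summation_by_parts (R : realType) (n tau T : nat)
    (p x v : nat -> 'rV[R]_n) : (tau <= T)%N ->
  (\sum_(tau.+1 <= t < T.+1) (dot (x t.-1) (Delta p t) + dot (v t) (p t))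
     + dot (x T) (- p T) =
   \sum_(tau.+1 <= t < T.+1) dot (p t) (v t - Delta x t)
     - dot (x tau) (p tau))%R.
Proof.
move=> tT; rewrite (eq_bigr (fun t => dot (p t) (v t - Delta x t) +
    (dot (x t) (p t) - dot (x t.-1) (p t.-1))))%R; last first.
  move=> t _; rewrite /dot -sumrN -!big_split /=; apply: eq_bigr => i _.
  by rewrite !mxE; ring.
rewrite big_split /= [X in (_ + X + _)%R](_ : _ =
    \sum_(tau <= t < T) (dot (x t.+1) (p t.+1) - dot (x t) (p t)))%R; last first.
  by rewrite big_add1.
rewrite telescope_sumr//.
have -> : (dot (x T) (- p T) = - dot (x T) (p T))%R.
  by rewrite /dot -sumrN; apply: eq_bigr => i _; rewrite mxE mulrN.
ring.
Qed.

(** With [-oo] excluded, a single value [+oo] among the [F t] and [c] turns both sides into [-oo];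
    otherwise everything is real. *)
Lemma sum_EFin_sub (R : realType) (J : eqType) (s : seq J) (a : J -> R)
    (F : J -> \bar R) (b : R) (c : \bar R) :
  (forall t, t \in s -> -oo < F t) -> -oo < c ->
  \sum_(t <- s) ((a t)%:E - F t) + (b%:E - c) =
  (\sum_(t <- s) a t + b)%:E - (\sum_(t <- s) F t + c).
Proof.
elim: s b c => [|t s IH] b c FN cN; first by rewrite !big_nil !add0e add0r.
rewrite !big_cons.
have FtN := FN t (mem_head _ _).
(* The head is absorbed into the pair [b], [c], over which the induction is general. *)
have -> : (a t)%:E - F t + \sum_(j <- s) ((a j)%:E - F j) + (b%:E - c) =
    \sum_(j <- s) ((a j)%:E - F j) + ((a t + b)%:E - (F t + c)).
  rewrite -addeA addeCA; congr (_ + _).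
  case: (F t) c FtN cN => [f| |] [c| |]//= _ _.
  by rewrite -!EFinD; congr EFin; ring.
rewrite IH//; last 2 first.
- by move=> i si; apply: FN; rewrite inE si orbT.
- by rewrite ltNye adde_eq_ninfty negb_or -!ltNye FtN.
by rewrite addeCA addeA addrCA addrA.
Qed.

Lemma sum_fin_num_inv (R : realType) (J : eqType) (s : seq J)
    (F : J -> \bar R) (c : \bar R) :
  (forall t, t \in s -> -oo < F t) -> -oo < c ->
  \sum_(t <- s) F t + c < +oo ->
  (forall t, t \in s -> F t \is a fin_num) /\ c \is a fin_num.
Proof.
elim: s c => [|t s IH] c FN cN.
  by rewrite big_nil add0e => coo; rewrite fin_numElt cN.
have FtN := FN t (mem_head _ _).
rewrite big_cons -addeA addeCA => H.
have [|||Fs] := IH (F t + c) => //.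
- by move=> i si; apply: FN; rewrite inE si orbT.
- by rewrite ltNye adde_eq_ninfty negb_or -!ltNye FtN.
rewrite fin_numD => /andP[Ft cfin]; split => // i.
by rewrite inE => /predU1P[->|/Fs].
Qed.

Lemma sum_fine_EFin (R : realType) (J : eqType) (s : seq J)
    (F : J -> \bar R) (c : \bar R) :
  (forall t, t \in s -> F t \is a fin_num) -> c \is a fin_num ->
  \sum_(t <- s) F t + c = (\sum_(t <- s) fine (F t) + fine c)%:E.
Proof.
move=> Ff cf; rewrite EFinD fineK//; congr (_ + _).
by rewrite -sumEFin; apply: eq_big_seq => t /Ff Ft; rewrite fineK.
Qed.

(** * Weak and strong duality *)

(** Each supremum in the dual cost dominates its value along [x]; after summation by parts only the
    boundary term at [tau] survives. *)
Lemma weak_duality (R : realType) (T n tau : nat)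
    (L : nat -> 'rV[R]_n * 'rV[R]_n -> \bar R) (g : 'rV[R]_n -> \bar R)
    (x p : nat -> 'rV[R]_n) (eta : 'rV[R]_n) :
  (tau <= T)%N -> (forall t z, (1 <= t <= T)%N -> -oo < L t z) ->
  (forall y, -oo < g y) -> p tau = (- eta)%R ->
  (dot (x tau) eta)%:E - primal_cost T L g tau x <= dual_cost T L g tau p.
Proof.
move=> tT LN gN ptau.
pose a t := (dot (x t.-1) (Delta p t) + dot (Delta x t) (p t))%R.
apply: (@le_trans _ _ (\sum_(tau.+1 <= t < T.+1)
    ((a t)%:E - L t (x t.-1, Delta x t)) + ((dot (x T) (- p T))%:E - g (x T)))).
  rewrite sum_EFin_sub//; last first.
    move=> t; rewrite mem_index_iota => /andP[t1 t2]; apply: LN.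
    by rewrite (leq_trans _ t1).
  rewrite summation_by_parts// ptau big1; last first.
    by move=> t _; rewrite subrr /dot big1// => i _; rewrite mxE mulr0.
  suff -> : (dot (x tau) eta = 0 - dot (x tau) (- eta))%R by [].
  by rewrite sub0r /dot -sumrN; apply: eq_bigr => i _; rewrite mxE; ring.
apply: leeD; last by apply: ereal_sup_ubound; exists (x T).
by apply: lee_sum => t _; apply: ereal_sup_ubound; exists (x t.-1, Delta x t).
Qed.

(** Applied with [M] equal to the conjugate of the primal value at [eta], this excludes a duality
    gap and provides attainment together. *)
Lemma strong_duality (R : realType) (T n tau : nat)
    (L : nat -> 'rV[R]_n * 'rV[R]_n -> \bar R) (g : 'rV[R]_n -> \bar R)
    (xb : nat -> 'rV[R]_n) (eta : 'rV[R]_n) :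
  (tau <= T)%N ->
  (forall t, (tau < t <= T)%N -> eproper (L t)) ->
  (forall t, (tau < t <= T)%N -> econvex (L t)) ->
  eproper g -> econvex g -> relint (edom g) (xb T) ->
  (forall t, (tau < t <= T)%N ->
     relint (Xset L t) (xb t.-1) /\ relint (GammaL L t (xb t.-1)) (Delta xb t)) ->
  forall M : R,
  (forall x, (dot (x tau) eta)%:E - primal_cost T L g tau x <= M%:E) ->
  exists p, p tau = (- eta)%R /\ dual_cost T L g tau p <= M%:E.
Proof.
move=> tT Lp Lc gp gc xbT qual M HM.
have [_ gN] := gp.
have LN t : (tau < t <= T)%N -> forall z, -oo < L t z by move=> /Lp[].
pose I := index_iota tau.+1 T.+1.
have memI t : (t \in I) = (tau < t <= T)%N by rewrite mem_index_iota.
pose Z := ((nat -> 'rV[R]_n) * (nat -> 'rV[R]_n))%type.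
pose D : set Z := [set z | (forall t, t \in I -> L t (z.1 t.-1, z.2 t) \is a fin_num)
  /\ g (z.1 T) \is a fin_num].
(* [HM] makes [h] nonnegative at the points of [D] where all the constraints [l] vanish. *)
pose h (z : Z) := (\sum_(t <- I) fine (L t (z.1 t.-1, z.2 t)) + fine (g (z.1 T))
  - dot (z.1 tau) eta + M)%R.
pose l (j : nat * 'I_n) (z : Z) := ((z.2 j.1 - Delta z.1 j.1) 0 j.2)%R.
pose s := [seq (t, i) | t <- I, i <- enum 'I_n].
have us : uniq s.
  apply: allpairs_uniq; [exact: iota_uniq | exact: enum_uniq|].
  by move=> [a b] [c d] _ _ [-> ->].
have Dc : convex_subset D.
  move=> z w c c01 [Lz gz] [Lw gw]; split.
    move=> t tI; have tI' := tI; rewrite memI in tI'.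
    exact: (convex_fin_num _ _ _ (Lc t tI') (LN t tI') _ _ _ c01
      (Lz t tI) (Lw t tI)).
  exact: (convex_fin_num _ _ _ gc gN _ _ _ c01 gz gw).
have hc : convex_on D h.
  move=> z w c c01 [Lz gz] [Lw gw].
  have H1 : (\sum_(t <- I) fine (L t ((mix c z w).1 t.-1, (mix c z w).2 t)) <=
     c * \sum_(t <- I) fine (L t (z.1 t.-1, z.2 t)) +
     (1 - c) * \sum_(t <- I) fine (L t (w.1 t.-1, w.2 t)))%R.
    rewrite !mulr_sumr -big_split /= [leLHS]big_seq [leRHS]big_seq.
    apply: ler_sum => t tI; have tI' := tI; rewrite memI in tI'.
    exact: (convex_on_fine _ _ _ (Lc t tI') (LN t tI') _ _ _ c01
      (Lz t tI) (Lw t tI)).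
  have H2 : (fine (g ((mix c z w).1 T)) <=
      c * fine (g (z.1 T)) + (1 - c) * fine (g (w.1 T)))%R.
    exact: (convex_on_fine _ _ _ gc gN _ _ _ c01 gz gw).
  have H3 : (dot ((mix c z w).1 tau) eta =
      c * dot (z.1 tau) eta + (1 - c) * dot (w.1 tau) eta)%R.
    rewrite /dot !mulr_sumr -big_split; apply: eq_bigr => i _ /=.
    by rewrite !mxE; ring.
  by rewrite /h H3; lra.
have la j : affine_form (l j).
  by move=> z w c; rewrite /l /Delta /= !mxE; ring.
have ls t z : t \in I -> (forall j, j \in s -> l j z = 0%R) ->
    z.2 t = Delta z.1 t.
  move=> tI l0; apply/rowP => i.
  have ts : (t, i) \in s by apply: allpairs_f; rewrite ?mem_enum.
  by have := l0 _ ts; rewrite /l /= 2!mxE => /subr0_eq.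
have h0 z : D z -> (forall j, j \in s -> l j z = 0%R) -> (0 <= h z)%R.
  move=> [Lz gz] l0; have := HM z.1.
  rewrite /primal_cost (_ : \sum_(_ <= t < _) _ =
    \sum_(t <- I) L t (z.1 t.-1, z.2 t)); last first.
    by apply: eq_big_seq => t tI; rewrite (ls t).
  by rewrite sum_fine_EFin// -EFinB lee_fin /h; lra.
have gxb : g (xb T) \is a fin_num.
  by rewrite fin_numElt gN; exact: relint_sub xbT.
have lopp z : D z -> exists e z',
    [/\ (0 < e)%R, D z' & forall j, j \in s -> l j z' = (- e * l j z)%R].
  move=> [Lz gz].
  have [e1 e10 H1] : exists2 e0, (0 < e0)%R & forall t e, t \in I ->
      (0 < e <= e0)%R -> L t ((xb t.-1, Delta xb t)
        - e *: ((z.1 t.-1, z.2 t) - (xb t.-1, Delta xb t)))%R \is a fin_num.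
    apply: uniform_prolongation => t tI; have tI' := tI; rewrite memI in tI'.
    have [rx rv] := qual t tI'.
    exact: (graph_prolongs _ _ _ _ _ _ _ (Lp t tI') (Lc t tI') rx rv (Lz t tI)).
  have gz' : edom g (z.1 T) by rewrite /edom /= ltey_eq gz.
  have [e2 e20 ge2] := relint_prolong _ _ _ _ _ xbT gz'.
  have [e3 e30 H3] : prolongs [set y | g y \is a fin_num] (xb T) (z.1 T).
    apply: (convex_prolongs _ _ _ _ _ e2 (convex_fin_num _ _ _ gc gN)) => //.
    by rewrite /= fin_numElt gN.
  pose e := Num.min e1 e3.
  have e0 : (0 < e)%R by rewrite lt_min e10.
  (* The arc [xb] with its own increments has zero defect, so reflecting [z] through it with ratio
     [e] multiplies every defect by [- e]. *)
  exists e, ((fun t => xb t - e *: (z.1 t - xb t)),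
             (fun t => Delta xb t - e *: (z.2 t - Delta xb t)))%R; split => //.
    split; last by apply: H3; rewrite e0 ge_min lexx orbT.
    by move=> t tI; apply: H1 => //; rewrite e0 ge_min lexx.
  by move=> j _; rewrite /l /Delta /= !mxE; ring.
have [q qP] := lagrange_multipliers _ _ _ _ _ _ _ us Dc hc la h0 lopp.
(* The multipliers of the constraints at [t > tau] are the coordinates of [p t]. No constraint is
   attached to [tau], so the prescribed value can be put there. *)
pose p t := if t == tau then (- eta)%R else \row_i q (t, i).
have ptau : p tau = (- eta)%R by rewrite /p eqxx.
exists p; split => //.
(* Every supremum in the dual cost gives way to one arbitrary choice: [z t] in the Lagrangian terms,
   then [y] in the terminal one. *)
apply: sum_ereal_sup_addr_le; [exact: (0, 0)%R | exact: iota_uniq|] => z.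
rewrite addeC; apply: ereal_sup_addr_le => _ [y _ <-]; rewrite addeC.
rewrite sum_EFin_sub//; last by move=> t; rewrite memI => /LN.
have [cost|] := ltP (\sum_(t <- I) L t (z t) + g y) +oo; last first.
  by rewrite leye_eq => /eqP ->; rewrite leNye.
have [||Lz gy] := sum_fin_num_inv _ _ _ _ _ _ _ cost => //.
  by move=> t; rewrite memI => /LN.
(* [z t] holds the position at [t - 1] and the velocity at [t], hence the shift. As the relaxed
   problem does not link the two, any [z] and [y] come from some pair [(x, v)]. *)
pose x t := if t == T then y else (z t.+1).1.
pose v t := (z t).2.
have xT : x T = y by rewrite /x eqxx.
have xz t : t \in I -> z t = (x t.-1, v t).
  rewrite memI /x /v; case: t => // t /andP[_ tltT].
  by rewrite /= lt_eqF//; case: (z t.+1).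
rewrite sum_fine_EFin// -EFinB lee_fin -xT.
have Dxv : D (x, v).
  by split => [t tI|] /=; [rewrite -xz//; exact: Lz | rewrite xT].
have := qP _ Dxv; rewrite /s big_allpairs /h /=.
rewrite (eq_big_seq (fun t => dot (p t) (v t - Delta x t)))%R; last first.
  move=> t; rewrite memI big_enum /= => /andP[tt _].
  by apply: eq_bigr => i _; rewrite /l /p gt_eqF//= [in RHS]mxE.
rewrite [in X in (_ <= X -> _)%R](eq_big_seq (fun t => fine (L t (z t)))); last first.
  by move=> t tI; rewrite -xz.
rewrite [X in (_ -> X + _ - _ <= _)%R](eq_big_seq
  (fun t => dot (x t.-1) (Delta p t) + dot (v t) (p t)))%R; last first.
  by move=> t tI; rewrite xz.
rewrite summation_by_parts// ptau.
have -> : (dot (x tau) (- eta) = - dot (x tau) eta)%R.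
  by rewrite /dot -sumrN; apply: eq_bigr => i _; rewrite mxE; ring.
lra.
Qed.

Theorem proposition2p4 (R : realType) (T n : nat) (T_ge1 : (1 <= T)%N)
    (n_ge1 : (1 <= n)%N)
    (L : nat -> 'rV[R]_n * 'rV[R]_n -> \bar R) (g : 'rV[R]_n -> \bar R)
    (L_proper : forall t : nat, (1 <= t <= T)%N -> eproper (L t))
    (L_convex : forall t : nat, (1 <= t <= T)%N -> econvex (L t))
    (L_lsc : forall t : nat, (1 <= t <= T)%N -> lower_semicontinuous (L t))
    (g_proper : eproper g) (g_convex : econvex g)
    (g_lsc : lower_semicontinuous g)
    (qualification : exists xbar : nat -> 'rV[R]_n,
      relint (edom g) (xbar T) /\
      forall t : nat, (1 <= t <= T)%N ->
        relint (Xset L t) (xbar t.-1) /\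
        relint (GammaL L t (xbar t.-1)) (Delta xbar t)) :
  forall tau : nat, (tau <= T)%N ->
    conjugate (primal_value T L g tau) = dual_value T L g tau /\
    forall eta : 'rV[R]_n, edom (dual_value T L g tau) eta ->
      exists p : nat -> 'rV[R]_n,
        p tau = (- eta)%R /\ dual_cost T L g tau p = dual_value T L g tau eta.
Proof.
have [xb [xbT qual]] := qualification.
have [_ gN] := g_proper.
have LN t z : (1 <= t <= T)%N -> -oo < L t z by move=> /L_proper[].
move=> tau tauT.
have [ltT|leT] := ltnP tau T; last first.
  have {leT tauT} -> : tau = T by apply/eqP; rewrite eqn_leq tauT.
  have pvT : primal_value T L g T = g by apply/funext => y; rewrite /primal_value ltnn.
  have dvT eta : dual_value T L g T eta = conjugate g eta.
    by rewrite /dual_value ltnn /dual_terminal opprK.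
  split; first by apply/funext => eta; rewrite pvT dvT.
  (* With no time step left, only the value of the arc at [T] enters the cost. *)
  move=> eta _; exists (fun=> - eta)%R; split => //.
  by rewrite /dual_cost big_geq// add0e dvT /dual_terminal opprK.
have weak eta : conjugate (primal_value T L g tau) eta <= dual_value T L g tau eta.
  apply: ge_ereal_sup => _ [xi _ <-].
  rewrite /dual_value /primal_value ltT; apply: le_ereal_inf_tmp => _ [p ptau <-].
  rewrite ereal_infEN oppeK addeC; apply: ereal_sup_addr_le => _ [_ [x xtau <-] <-].
  by rewrite addeC -xtau; apply: weak_duality.
have strong eta : conjugate (primal_value T L g tau) eta < +oo ->
    exists p, p tau = (- eta)%R /\
      dual_cost T L g tau p <= conjugate (primal_value T L g tau) eta.
  move=> coo.
  have H x : (dot (x tau) eta)%:E - primal_cost T L g tau x <=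
      conjugate (primal_value T L g tau) eta.
    apply: (@le_trans _ _ ((dot (x tau) eta)%:E - primal_value T L g tau (x tau))).
      apply: leeB => //; rewrite /primal_value ltT.
      by apply: ereal_inf_lbound; exists x.
    by apply: ereal_sup_ubound; exists (x tau).
  have sub t : (tau < t <= T)%N -> (1 <= t <= T)%N.
    by move=> /andP[t0 ->]; rewrite (leq_trans _ t0).
  (* The finite cost of [xb] keeps the conjugate above [-oo], so it can serve as the real bound in
     [strong_duality]. *)
  have xbfin : primal_cost T L g tau xb \is a fin_num.
    rewrite /primal_cost sum_fine_EFin//.
      move=> t; rewrite mem_index_iota => /sub /qual[_]; exact: relint_sub.
    by rewrite fin_numElt gN; exact: relint_sub xbT.
  have cfin : conjugate (primal_value T L g tau) eta \is a fin_num.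
    rewrite fin_numElt coo andbT; apply: lt_le_trans (H xb).
    by rewrite -(fineK xbfin) -EFinB ltNyr.
  move: H; rewrite -(fineK cfin) => H.
  apply: (strong_duality _ _ _ _ _ _ xb) => // t /sub; [exact: L_proper|
    exact: L_convex | exact: qual].
have attained eta : conjugate (primal_value T L g tau) eta < +oo ->
    exists p, [/\ p tau = (- eta)%R,
      dual_cost T L g tau p = dual_value T L g tau eta &
      dual_value T L g tau eta = conjugate (primal_value T L g tau) eta].
  move=> /strong[p [ptau pc]]; exists p.
  have dp : dual_value T L g tau eta <= dual_cost T L g tau p.
    by rewrite /dual_value ltT; apply: ereal_inf_lbound; exists p.
  have E : dual_value T L g tau eta = conjugate (primal_value T L g tau) eta.
    by apply/le_anti; rewrite weak (le_trans dp pc).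
  by split => //; apply/le_anti; rewrite dp E pc.
have E : conjugate (primal_value T L g tau) = dual_value T L g tau.
  apply/funext => eta.
  have [/attained[p [_ _ ->//]]|] :=
    ltP (conjugate (primal_value T L g tau) eta) +oo.
  (* Where the conjugate is [+oo], weak duality alone forces equality. *)
  rewrite leye_eq => /eqP coo; have := weak eta.
  by rewrite coo leye_eq => /eqP.
split => // eta; rewrite -E => /attained[p [ptau pc _]].
by exists p; rewrite E.
Qed.
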